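(* Let $w$ be a weight structure on a triangulated category $\mathcal{C}$. Let $u : M_- \to M_+$ be a morphism in $\mathcal{C}$ with $M_- \in \mathcal{C}_{w \le 0}$ and $M_+ \in \mathcal{C}_{w \ge 0}$, and let $$C \stackrel{v_-}{\longrightarrow} M_- \stackrel{u}{\longrightarrow} M_+ \stackrel{v_+}{\longrightarrow} C[1]$$ be an exact triangle in $\mathcal{C}$. Suppose that $C$ is without weights $-1$ and $0$, i.e., that it admits a weight filtration $$C_{\le -2} \stackrel{c_-}{\longrightarrow} C \stackrel{c_+}{\longrightarrow} C_{\ge 1} \stackrel{\delta_C}{\longrightarrow} C_{\le -2}[1]$$ avoiding weights $-1$ and $0$. Then: (a) The object $M_-$ is without weight $-1$, and $M_+$ is without weight $1$. (b) The morphisms $v_- \circ c_- : C_{\le -2} \to M_-$ and $\pi_0 : M_- \to \mathrm{Gr}_0 M_-$, respectively $i_0 : \mathrm{Gr}_0 M_+ \to M_+$ and $(c_+[1]) \circ v_+ : M_+ \to C_{\ge 1}[1]$, can be canonically extended to exact triangles $$(3)\quad C_{\le -2} \stackrel{v_- c_-}{\longrightarrow} M_- \stackrel{\pi_0}{\longrightarrow} \mathrm{Gr}_0 M_- \stackrel{\delta_-}{\longrightarrow} C_{\le -2}[1]$$ and $$(4)\quad C_{\ge 1} \stackrel{\delta_+}{\longrightarrow} \mathrm{Gr}_0 M_+ \stackrel{i_0}{\longrightarrow} M_+ \stackrel{(c_+[1]) v_+}{\longrightarrow} C_{\ge 1}[1] .$$ Thus, (3) is a weight filtration of $M_-$ avoiding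 weight $-1$, and (4) is a weight filtration of $M_+$ avoiding weight $1$. (c) There is a canonical isomorphism $\alpha : \mathrm{Gr}_0 M_- \to \mathrm{Gr}_0 M_+$. As a morphism, it is uniquely determined by the property $i_0 \circ \alpha \circ \pi_0 = u$. Its inverse satisfies $\delta_- \circ \alpha^{-1} \circ \delta_+ = \delta_C$.
   Context: A weight structure on a triangulated category $\mathcal{C}$ is a pair $w=(\mathcal{C}_{w\le 0},\mathcal{C}_{w\ge 0})$ of full subcategories such that, putting $\mathcal{C}_{w\le n}:=\mathcal{C}_{w\le 0}[n]$ and $\mathcal{C}_{w\ge n}:=\mathcal{C}_{w\ge 0}[n]$ for $n\in\mathbb{Z}$: (1) $\mathcal{C}_{w\le 0}$ and $\mathcal{C}_{w\ge 0}$ are closed under direct summands formed in $\mathcal{C}$; (2) $\mathcal{C}_{w\le 0}\subset\mathcal{C}_{w\le 1}$ and $\mathcal{C}_{w\ge 1}\subset\mathcal{C}_{w\ge 0}$; (3) $\mathrm{Hom}_{\mathcal{C}}(M,N)=0$ for all $M\in\mathcal{C}_{w\le 0}$, $N\in\mathcal{C}_{w\ge 1}$; (4) for every $M\in\mathcal{C}$ there is an exact triangle $A\to M\to B\to A[1]$ with $A\in\mathcal{C}_{w\le 0}$, $B\in\mathcal{C}_{w\ge 1}$. The heart $\mathcal{C}_{w=0}$ is the full subcategory of objects lying in both $\mathcal{C}_{w\le 0}$ and $\mathcal{C}_{w\ge 0}$. For integers $m\le n$, a weight filtration of $M$ avoiding weights $m,\dots,n$ is an exact triangle $M_{\le m-1}\to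 M\to M_{\ge n+1}\to M_{\le m-1}[1]$ with $M_{\le m-1}\in\mathcal{C}_{w\le m-1}$ and $M_{\ge n+1}\in\mathcal{C}_{w\ge n+1}$. The object $M$ is without weights $m,\dots,n$ if it admits such a weight filtration (it is then unique up to unique isomorphism). The inclusion of the heart into the full subcategory of objects of $\mathcal{C}_{w\le 0}$ without weight $-1$ has a left adjoint $\mathrm{Gr}_0$, sending $M$ to the term $M_{\ge 0}$ of a weight filtration $M_{\le -2}\to M\to M_{\ge 0}\to M_{\le -2}[1]$ avoiding weight $-1$; $\pi_0:M\to\mathrm{Gr}_0 M$ denotes the adjunction morphism (the morphism $M\to M_{\ge 0}$). The inclusion of the heart into the full subcategory of objects of $\mathcal{C}_{w\ge 0}$ without weight $1$ has a right adjoint, also denoted $\mathrm{Gr}_0$, sending $M$ to the term $M_{\le 0}$ of a weight filtration $M_{\le 0}\to M\to M_{\ge 2}\to M_{\le 0}[1]$ avoiding weight $1$; $i_0:\mathrm{Gr}_0 M\to M$ denotes the adjunction morphism (the morphism $M_{\le 0}\to M$). *)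

(* Defs.v *)
From HB Require Import structures.
From mathcomp Require Import all_boot all_order all_algebra.

Set Implicit Arguments.
Unset Strict Implicit.
Unset Printing Implicit Defensive.

Import GRing.Theory.
Local Open Scope ring_scope.

Declare Scope cat_scope.
Delimit Scope cat_scope with cat.
Local Open Scope cat_scope.

Record preadditive := Preadditive {
  ob :> Type;
  mor : ob -> ob -> zmodType;
  idm : forall X, mor X X;
  mcomp : forall X Y Z, mor Y Z -> mor X Y -> mor X Z;
  mcompA : forall W X Y Z (h : mor Y Z) (g : mor X Y) (f : mor W X),
    mcomp h (mcomp g f) = mcomp (mcomp h g) f;
  mcomp1m : forall X Y (f : mor X Y), mcomp (idm Y) f = f;
  mcompm1 : forall X Y (f : mor X Y), mcomp f (idm X) = f;
  mcompDl : forall X Y Z (g g' : mor Y Z) (f : mor X Y),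
    mcomp (g + g') f = mcomp g f + mcomp g' f;
  mcompDr : forall X Y Z (g : mor Y Z) (f f' : mor X Y),
    mcomp g (f + f') = mcomp g f + mcomp g f'
}.

Arguments mor {p} X Y.
Arguments idm {p} X.
Arguments mcomp {p X Y Z} g f.

Notation "g ∘ f" := (mcomp g f) (at level 40, left associativity) : cat_scope.

Definition inverse_morphisms (C : preadditive) (X Y : C)
    (f : mor X Y) (g : mor Y X) : Prop :=
  g ∘ f = idm X /\ f ∘ g = idm Y.

Definition is_iso (C : preadditive) (X Y : C) (f : mor X Y) : Prop :=
  exists g : mor Y X, inverse_morphisms f g.

Definition isomorphic (C : preadditive) (X Y : C) : Prop :=
  exists f : mor X Y, is_iso f.

Definition is_zero (C : preadditive) (Z : C) : Prop :=
  forall X : C, (forall f : mor X Z, f = 0) /\ (forall f : mor Z X, f = 0).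

Definition is_biproduct (C : preadditive) (X Y B : C)
    (iX : mor X B) (iY : mor Y B) (pX : mor B X) (pY : mor B Y) : Prop :=
  [/\ pX ∘ iX = idm X, pY ∘ iY = idm Y, pX ∘ iY = 0, pY ∘ iX = 0
    & iX ∘ pX + iY ∘ pY = idm B].

Definition direct_summand (C : preadditive) (X B : C) : Prop :=
  exists (Y : C) (iX : mor X B) (iY : mor Y B) (pX : mor B X) (pY : mor B Y),
    is_biproduct iX iY pX pY.

Record additive_functor (C D : preadditive) := AdditiveFunctor {
  fob :> C -> D;
  fmap : forall X Y : C, mor X Y -> mor (fob X) (fob Y);
  fmap1 : forall X : C, fmap (idm X) = idm (fob X);
  fmapM : forall (X Y Z : C) (g : mor Y Z) (f : mor X Y),
    fmap (g ∘ f) = fmap g ∘ fmap f;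
  fmapD : forall (X Y : C) (f g : mor X Y), fmap (f + g) = fmap f + fmap g
}.

Arguments fmap {C D} F {X Y} f : rename.

Record autoequivalence (C : preadditive) := Autoequivalence {
  eqv_fun : additive_functor C C;
  eqv_inv : additive_functor C C;
  eqv_unit : forall X : C, mor X (eqv_inv (eqv_fun X));
  eqv_unit_iso : forall X : C, is_iso (eqv_unit X);
  eqv_unit_nat : forall (X Y : C) (f : mor X Y),
    eqv_unit Y ∘ f = fmap eqv_inv (fmap eqv_fun f) ∘ eqv_unit X;
  eqv_counit : forall X : C, mor (eqv_fun (eqv_inv X)) X;
  eqv_counit_iso : forall X : C, is_iso (eqv_counit X);
  eqv_counit_nat : forall (X Y : C) (f : mor X Y),
    eqv_counit Y ∘ fmap eqv_fun (fmap eqv_inv f) = f ∘ eqv_counit X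
}.

(* [exact f g h] says that  X --f--> Y --g--> Z --h--> X[1]  is an exact
   (distinguished) triangle.  As usual, the shift X |-> X[1] is only required
   to be an autoequivalence, not a strict automorphism. *)
Record triangulated := Triangulated {
  tcat :> preadditive;
  shift_eqv : autoequivalence tcat;
  shift := eqv_fun shift_eqv;
  exact : forall X Y Z : tcat,
    mor X Y -> mor Y Z -> mor Z (shift X) -> Prop;
  zero_ex : exists Z : tcat, is_zero Z;
  biproduct_ex : forall X Y : tcat, exists (B : tcat)
    (iX : mor X B) (iY : mor Y B) (pX : mor B X) (pY : mor B Y),
    is_biproduct iX iY pX pY;
  exact_iso : forall (X Y Z X' Y' Z' : tcat)
    (f : mor X Y) (g : mor Y Z) (h : mor Z (shift X))
    (f' : mor X' Y') (g' : mor Y' Z') (h' : mor Z' (shift X'))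
    (a : mor X X') (b : mor Y Y') (c : mor Z Z'),
    is_iso a -> is_iso b -> is_iso c ->
    b ∘ f = f' ∘ a -> c ∘ g = g' ∘ b -> fmap shift a ∘ h = h' ∘ c ->
    exact f g h -> exact f' g' h';
  exact_id : forall X Z : tcat, is_zero Z ->
    exact (idm X) (0 : mor X Z) (0 : mor Z (shift X));
  exact_cone : forall (X Y : tcat) (f : mor X Y),
    exists (Z : tcat) (g : mor Y Z) (h : mor Z (shift X)), exact f g h;
  exact_rot : forall (X Y Z : tcat)
    (f : mor X Y) (g : mor Y Z) (h : mor Z (shift X)),
    exact f g h <-> exact g h (- fmap shift f);
  exact_fill : forall (X Y Z X' Y' Z' : tcat)
    (f : mor X Y) (g : mor Y Z) (h : mor Z (shift X))
    (f' : mor X' Y') (g' : mor Y' Z') (h' : mor Z' (shift X'))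
    (a : mor X X') (b : mor Y Y'),
    exact f g h -> exact f' g' h' -> b ∘ f = f' ∘ a ->
    exists c : mor Z Z', c ∘ g = g' ∘ b /\ fmap shift a ∘ h = h' ∘ c;
  exact_octahedron : forall (X Y Z X' Y' Z' : tcat)
    (f : mor X Y) (f1 : mor Y Z') (f2 : mor Z' (shift X))
    (g : mor Y Z) (g1 : mor Z X') (g2 : mor X' (shift Y))
    (k1 : mor Z Y') (k2 : mor Y' (shift X)),
    exact f f1 f2 -> exact g g1 g2 -> exact (g ∘ f) k1 k2 ->
    exists (a : mor Z' Y') (b : mor Y' X'),
      [/\ exact a b (fmap shift f1 ∘ g2),
          a ∘ f1 = k1 ∘ g, b ∘ k1 = g1, k2 ∘ a = f2
        & g2 ∘ b = fmap shift f ∘ k2]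
}.

Arguments shift {t} : rename.
Arguments exact {t X Y Z} f g h : rename.

Notation "X ⟦1⟧" := (fob shift X) (at level 2, format "X ⟦1⟧") : cat_scope.
Notation "f ⟦1⟧m" := (fmap shift f) (at level 2, format "f ⟦1⟧m") : cat_scope.

Definition unshift (C : triangulated) : additive_functor C C :=
  eqv_inv (shift_eqv C).

Definition shiftn (C : triangulated) (n : int) (X : C) : C :=
  match n with
  | Posz k => iter k (fob shift) X
  | Negz k => iter k.+1 (fob (unshift C)) X
  end.

(* A full subcategory is given by a predicate P on objects; P[n] is taken to be
   closed under isomorphism, the shift being only an autoequivalence. *)
Definition shifted (C : triangulated) (P : C -> Prop) (n : int) (X : C) : Prop :=
  exists2 Y : C, P Y & isomorphic X (shiftn n Y).

Record weight_structure (C : triangulated) := WeightStructure {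
  wle0 : C -> Prop;
  wge0 : C -> Prop;
  wle0_summand : forall X Y : C, direct_summand X Y -> wle0 Y -> wle0 X;
  wge0_summand : forall X Y : C, direct_summand X Y -> wge0 Y -> wge0 X;
  wle0_sub : forall X : C, wle0 X -> shifted wle0 1 X;
  wge0_sub : forall X : C, shifted wge0 1 X -> wge0 X;
  w_orth : forall M N : C, wle0 M -> shifted wge0 1 N ->
    forall f : mor M N, f = 0;
  w_decomp : forall M : C, exists (A B : C)
    (f : mor A M) (g : mor M B) (h : mor B A⟦1⟧),
    [/\ exact f g h, wle0 A & shifted wge0 1 B]
}.

Definition wle (C : triangulated) (w : weight_structure C) (n : int) :
  C -> Prop := shifted (wle0 w) n.

Definition wge (C : triangulated) (w : weight_structure C) (n : int) :
  C -> Prop := shifted (wge0 w) n.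

Definition heart (C : triangulated) (w : weight_structure C) (X : C) : Prop :=
  wle0 w X /\ wge0 w X.

Definition weight_filtration_avoiding (C : triangulated)
    (w : weight_structure C) (m n : int) (A M B : C)
    (f : mor A M) (g : mor M B) (h : mor B A⟦1⟧) : Prop :=
  [/\ m <= n, exact f g h, wle w (m - 1) A & wge w (n + 1) B].

Definition without_weights (C : triangulated) (w : weight_structure C)
    (m n : int) (M : C) : Prop :=
  exists (A B : C) (f : mor A M) (g : mor M B) (h : mor B A⟦1⟧),
    weight_filtration_avoiding w m n f g h.

(* [is_Gr0_left w pi], for pi : M -> G, says that G and pi are the value at M
   and the adjunction morphism at M of the left adjoint Gr_0 of the inclusion of
   the heart (the universal arrow from M to that inclusion).  As all the
   subcategories involved are full, the domain of the adjoint, which is the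
   category of objects of weights <= 0 without weight -1, does not enter. *)
Definition is_Gr0_left (C : triangulated) (w : weight_structure C)
    (M G : C) (pi : mor M G) : Prop :=
  heart w G /\
  forall N : C, heart w N -> forall f : mor M N,
    exists! g : mor G N, g ∘ pi = f.

(* The same for the right adjoint Gr_0 of the inclusion of the heart into the
   objects of weights >= 0 without weight 1, and its adjunction morphism i. *)
Definition is_Gr0_right (C : triangulated) (w : weight_structure C)
    (M G : C) (i : mor G M) : Prop :=
  heart w G /\
  forall N : C, heart w N -> forall f : mor N M,
    exists! g : mor N G, i ∘ g = f.

(* Main.v *)
Require Import Defs.
From HB Require Import structures.
From mathcomp Require Import all_boot all_order all_algebra.

Set Implicit Arguments.
Unset Strict Implicit.
Unset Printing Implicit Defensive.

Import GRing.Theory.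
Local Open Scope ring_scope.
Local Open Scope cat_scope.

(** Apply the octahedral axiom to the composite [vm ∘ cm].  A cone [G] of it
    sits both in a triangle [Cle -> Mm -> G -> Cle⟦1⟧] and in a triangle
    [Cge -> G -> Mp -> Cge⟦1⟧], the composite [Mm -> G -> Mp] is [u], and the
    composite [Cge -> G -> Cle⟦1⟧] is [dC].  The first triangle exhibits [G] as
    an extension of objects of weights at most 0, the second as an extension of
    objects of weights at least 0; since both classes are orthogonals of one
    another up to a shift ([wle0_of_orth], [wge0_of_orth]), they are closed
    under extensions, and [G] lies in the heart.  So the two triangles are
    weight filtrations of [Mm] avoiding -1 and of [Mp] avoiding 1.

    Orthogonality also makes [Mm -> G] universal among arrows from [Mm] to the
    heart, and [G -> Mp] universal among arrows from the heart to [Mp]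
    ([Gr0_left_of_exact], [Gr0_right_of_exact]).  Any choice of [Gr_0 Mm] and
    of [Gr_0 Mp] is therefore uniquely isomorphic to [G] compatibly with the
    adjunction morphisms, and [alpha] is the composite isomorphism
    [Gr_0 Mm -> G -> Gr_0 Mp]; its properties are the two composition formulas
    of the octahedron.  Uniqueness of the connecting morphisms holds because an
    endomorphism of a triangle which is the identity on two terms is, by the
    universal property, the identity on the third. *)

(** * Preadditive categories and isomorphisms *)

Section Preadditive.
Variable C : preadditive.

Lemma mcomp0m (X Y Z : C) (f : mor X Y) : (0 : mor Y Z) ∘ f = 0.
Proof. by apply: (addrI ((0 : mor Y Z) ∘ f)); rewrite -mcompDl !addr0. Qed.

Lemma mcompm0 (X Y Z : C) (g : mor Y Z) : g ∘ (0 : mor X Y) = 0.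
Proof. by apply: (addrI (g ∘ (0 : mor X Y))); rewrite -mcompDr !addr0. Qed.

Lemma mcompNm (X Y Z : C) (g : mor Y Z) (f : mor X Y) : (- g) ∘ f = - (g ∘ f).
Proof. by apply: (addrI (g ∘ f)); rewrite -mcompDl !subrr mcomp0m. Qed.

Lemma mcompmN (X Y Z : C) (g : mor Y Z) (f : mor X Y) : g ∘ (- f) = - (g ∘ f).
Proof. by apply: (addrI (g ∘ f)); rewrite -mcompDr !subrr mcompm0. Qed.

Lemma mcompBl (X Y Z : C) (g g' : mor Y Z) (f : mor X Y) :
  (g - g') ∘ f = g ∘ f - g' ∘ f.
Proof. by rewrite mcompDl mcompNm. Qed.

Lemma mcompBr (X Y Z : C) (g : mor Y Z) (f f' : mor X Y) :
  g ∘ (f - f') = g ∘ f - g ∘ f'.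
Proof. by rewrite mcompDr mcompmN. Qed.

Lemma is_zero_id (Z : C) : idm Z = 0 -> is_zero Z.
Proof.
move=> id0 X; split=> f.
  by rewrite -(mcomp1m f) id0 mcomp0m.
by rewrite -(mcompm1 f) id0 mcompm0.
Qed.

Lemma is_iso_id (X : C) : is_iso (idm X).
Proof. by exists (idm X); split; rewrite mcomp1m. Qed.

Lemma iso_mono (X Y Z : C) (f : mor Y Z) (g g' : mor X Y) :
  is_iso f -> f ∘ g = f ∘ g' -> g = g'.
Proof.
by move=> [k [kf _]] e; rewrite -(mcomp1m g) -kf -mcompA e mcompA kf mcomp1m.
Qed.

Lemma iso_epi (X Y Z : C) (f : mor X Y) (g g' : mor Y Z) :
  is_iso f -> g ∘ f = g' ∘ f -> g = g'.
Proof.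
by move=> [k [_ fk]] e; rewrite -(mcompm1 g) -fk mcompA e -mcompA fk mcompm1.
Qed.

Lemma isomorphic_sym (X Y : C) : isomorphic X Y -> isomorphic Y X.
Proof. by case=> f [g [gf fg]]; exists g, f; split. Qed.

Lemma isomorphic_trans (Y X Z : C) :
  isomorphic X Y -> isomorphic Y Z -> isomorphic X Z.
Proof.
case=> f [f' [f'f ff']] [g [g' [g'g gg']]]; exists (g ∘ f), (f' ∘ g'); split.
  by rewrite -mcompA (mcompA g') g'g mcomp1m.
by rewrite -mcompA (mcompA f) ff' mcomp1m.
Qed.

End Preadditive.

Section Functor.
Variables (C D : preadditive) (F : additive_functor C D).

Lemma fmap0 (X Y : C) : fmap F (0 : mor X Y) = 0.
Proof. by apply: (addrI (fmap F (0 : mor X Y))); rewrite -fmapD !addr0. Qed.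

Lemma is_zero_fob (Z : C) : is_zero Z -> is_zero (fob F Z).
Proof.
by move=> z; apply: is_zero_id; rewrite -fmap1 (proj1 (z Z) (idm Z)) fmap0.
Qed.

Lemma isomorphic_fob (X Y : C) :
  isomorphic X Y -> isomorphic (fob F X) (fob F Y).
Proof.
case=> f [g [gf fg]]; exists (fmap F f), (fmap F g).
by split; rewrite -fmapM ?gf ?fg fmap1.
Qed.

End Functor.

(** * Triangulated categories *)

Section Triangulated.
Variable T : triangulated.

Lemma unshift_shift (X : T) : isomorphic X (fob (unshift T) X⟦1⟧).
Proof. by exists (eqv_unit (shift_eqv T) X); apply: eqv_unit_iso. Qed.

Lemma shift_unshift (X : T) : isomorphic (fob (unshift T) X)⟦1⟧ X.
Proof. by exists (eqv_counit (shift_eqv T) X); apply: eqv_counit_iso. Qed.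

Lemma shift_inj (X Y : T) (f g : mor X Y) : f⟦1⟧m = g⟦1⟧m -> f = g.
Proof.
move=> e; apply: (iso_mono (eqv_unit_iso (shift_eqv T) Y)).
by rewrite !eqv_unit_nat -/shift e.
Qed.

Lemma unshift_inj (X Y : T) (f g : mor X Y) :
  fmap (unshift T) f = fmap (unshift T) g -> f = g.
Proof.
move=> e; apply: (iso_epi (eqv_counit_iso (shift_eqv T) X)).
by rewrite -!eqv_counit_nat -/(unshift T) e.
Qed.

(** Any inverse to the shift is faithful as well, so it suffices to compare
    images under it; there the naturality of the unit applies. *)
Lemma shift_full (X Y : T) (f : mor X⟦1⟧ Y⟦1⟧) : exists g : mor X Y, g⟦1⟧m = f.
Proof.
have [k [_ uk]] := eqv_unit_iso (shift_eqv T) Y.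
exists (k ∘ (fmap (unshift T) f ∘ eqv_unit (shift_eqv T) X)).
apply: unshift_inj; apply: (iso_epi (eqv_unit_iso (shift_eqv T) X)).
by rewrite -(eqv_unit_nat (shift_eqv T)) mcompA uk mcomp1m.
Qed.

Lemma exact_comp0 (X Y Z : T) (f : mor X Y) (g : mor Y Z) (h : mor Z X⟦1⟧) :
  exact f g h -> g ∘ f = 0.
Proof.
have [O zO] := zero_ex T => e.
have [|c [<- _]] := exact_fill (a := idm X) (b := f) (exact_id X zO) e.
  by rewrite mcompm1.
by rewrite mcompm0.
Qed.

(** Fill in a morphism to the triangle [O -> W -> W -> O⟦1⟧], [O] zero. *)
Lemma exact_weak_cokernel (X Y Z W : T)
    (f : mor X Y) (g : mor Y Z) (h : mor Z X⟦1⟧) (x : mor Y W) :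
  exact f g h -> x ∘ f = 0 -> exists y : mor Z W, x = y ∘ g.
Proof.
have [O zO] := zero_ex T => e xf.
have eW : exact (0 : mor O W) (idm W) 0.
  by apply/exact_rot; rewrite fmap0 oppr0; apply/exact_id/is_zero_fob.
have [|c [cg _]] := exact_fill (a := 0 : mor X O) (b := x) e eW.
  by rewrite xf mcompm0.
by exists c; rewrite cg mcomp1m.
Qed.

(** Filling in a morphism from [W -> O -> W⟦1⟧], [O] zero, to the rotated
    triangle gives the factorization only after a shift; it descends because the
    shift is fully faithful. *)
Lemma exact_weak_kernel (X Y Z W : T)
    (f : mor X Y) (g : mor Y Z) (h : mor Z X⟦1⟧) (x : mor W Y) :
  exact f g h -> g ∘ x = 0 -> exists y : mor W X, x = f ∘ y.
Proof.
have [O zO] := zero_ex T => /exact_rot e gx.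
have /exact_rot eW := exact_id W zO.
have [|c [_]] := exact_fill (a := x) (b := 0 : mor O Z) eW e.
  by rewrite gx mcompm0.
have [y <-] := shift_full c.
rewrite fmap1 mcompmN mcompm1 mcompNm => /oppr_inj; rewrite -fmapM => /shift_inj ->.
by exists y.
Qed.

(** The complement is the cone of [s]: its connecting morphism vanishes because
    [s⟦1⟧] is a split monomorphism, so [idm Y - s ∘ r], which kills [s], factors
    through the cone and gives the second inclusion. *)
Lemma retract_direct_summand (X Y : T) (s : mor X Y) (r : mor Y X) :
  r ∘ s = idm X -> direct_summand X Y.
Proof.
move=> rs; have [Z [p [q e]]] := exact_cone s.
have ps := exact_comp0 e.
have eY := proj1 (exact_rot _ _ _) e.
have q0 : q = 0.
  have := exact_comp0 (proj1 (exact_rot _ _ _) eY).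
  rewrite mcompNm => /eqP; rewrite oppr_eq0 => /eqP sq.
  by rewrite -(mcomp1m q) -fmap1 -rs fmapM -mcompA sq mcompm0.
have p_epi W (x : mor Z W) : x ∘ p = 0 -> x = 0.
  move=> xp; have [y ->] := exact_weak_cokernel eY xp.
  by rewrite q0 mcompm0.
have [|t tp] := exact_weak_cokernel (x := idm Y - s ∘ r) e.
  by rewrite mcompBl mcomp1m -mcompA rs mcompm1 subrr.
exists Z, s, t, r, p; split=> //.
- apply/eqP; rewrite -subr_eq0; apply/eqP/p_epi.
  by rewrite mcompBl -mcompA -tp mcompBr mcompm1 mcompA ps mcomp0m subr0
    mcomp1m subrr.
- apply: p_epi.
  by rewrite -mcompA -tp mcompBr mcompm1 mcompA rs mcomp1m subrr.
- by rewrite -tp addrC subrK.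
Qed.

Lemma isomorphic_direct_summand (X Y : T) : isomorphic X Y -> direct_summand X Y.
Proof. by case=> f [g [gf _]]; apply: retract_direct_summand gf. Qed.

(** * Weights *)

Variable w : weight_structure T.

Lemma wle0_isomorphic (X Y : T) : isomorphic X Y -> wle0 w Y -> wle0 w X.
Proof. by move=> i; apply/wle0_summand/isomorphic_direct_summand. Qed.

Lemma shifted0 (P : T -> Prop) (X : T) : P X -> shifted P 0 X.
Proof. by exists X => //; exists (idm X); apply: is_iso_id. Qed.

Lemma shifted1 (P : T -> Prop) (X : T) : P X -> shifted P 1 X⟦1⟧.
Proof. by exists X => //; exists (idm X⟦1⟧); apply: is_iso_id. Qed.

Lemma wge_shift (X : T) : wge w 1 X -> wge w 2 X⟦1⟧.
Proof. by case=> Y wY i; exists Y => //; apply: isomorphic_fob. Qed.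

Lemma wle_m1_shift (X : T) : wle w (-1) X -> wle0 w X⟦1⟧.
Proof.
case=> Y wY i; apply: wle0_isomorphic wY.
exact: isomorphic_trans (isomorphic_fob shift i) (shift_unshift Y).
Qed.

Lemma wle_m1_wle0 (X : T) : wle w (-1) X -> wle0 w X.
Proof.
case=> Y /wle0_sub[Z wZ j] i; apply: wle0_isomorphic wZ.
apply: isomorphic_trans i _.
apply: isomorphic_trans (isomorphic_fob (unshift T) j) _.
exact/isomorphic_sym/unshift_shift.
Qed.

Lemma wle_m2_shift (X : T) : wle w (-2) X -> wle w (-1) X⟦1⟧.
Proof.
case=> Y wY i; exists Y => //.
exact: isomorphic_trans (isomorphic_fob shift i) (shift_unshift _).
Qed.

Lemma wle0_wge1_orth (X N : T) (f : mor X N) : wle0 w X -> wge w 1 N -> f = 0.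
Proof. by move=> wX wN; apply: w_orth wX wN f. Qed.

Lemma wle_m1_wge0_orth (X N : T) (f : mor X N) :
  wle w (-1) X -> wge0 w N -> f = 0.
Proof.
move=> /wle_m1_shift wX wN; apply: shift_inj; rewrite fmap0.
exact: wle0_wge1_orth wX (shifted1 wN).
Qed.

(** The second map of a weight decomposition of [X] vanishes, so the first one
    is a split epimorphism and [X] is a summand of an object of [wle0 w]. *)
Lemma wle0_of_orth (X : T) :
  (forall N, wge w 1 N -> forall f : mor X N, f = 0) -> wle0 w X.
Proof.
move=> orth; have [A [B [f [g [h [e wA wB]]]]]] := w_decomp w X.
have [|s fs] := exact_weak_kernel (x := idm X) e.
  by rewrite (orth _ wB g) mcomp0m.
exact: wle0_summand (retract_direct_summand (esym fs)) wA.
Qed.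

(** Dual argument, on a weight decomposition of [X⟦1⟧]: its second map is a
    split monomorphism into the shift of an object of [wge0 w]. *)
Lemma wge0_of_orth (X : T) :
  (forall N, wle0 w N -> forall f : mor N X⟦1⟧, f = 0) -> wge0 w X.
Proof.
move=> orth; have [A [B [f [g [h [e wA]]]]]] := w_decomp w X⟦1⟧.
case=> Y wY [i [j [ji _]]].
have [|r rg] := exact_weak_cokernel (x := idm X⟦1⟧) e.
  by rewrite (orth _ wA f) mcompm0.
have [s sE] := shift_full (i ∘ g : mor X⟦1⟧ Y⟦1⟧).
have [t tE] := shift_full (r ∘ j : mor Y⟦1⟧ X⟦1⟧).
apply: wge0_summand wY; apply: (retract_direct_summand (s := s) (r := t)).
apply: shift_inj.
by rewrite fmapM sE tE fmap1 -mcompA (mcompA j) ji mcomp1m -rg.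
Qed.

Lemma wle0_extension (X Y Z : T)
    (f : mor X Y) (g : mor Y Z) (h : mor Z X⟦1⟧) :
  exact f g h -> wle0 w X -> wle0 w Z -> wle0 w Y.
Proof.
move=> e wX wZ; apply: wle0_of_orth => N wN x.
have [|y ->] := exact_weak_cokernel (x := x) e.
  exact: wle0_wge1_orth wN.
by rewrite (wle0_wge1_orth y wZ wN) mcomp0m.
Qed.

Lemma wge0_extension (X Y Z : T)
    (f : mor X Y) (g : mor Y Z) (h : mor Z X⟦1⟧) :
  exact f g h -> wge0 w X -> wge0 w Z -> wge0 w Y.
Proof.
move=> /exact_rot/exact_rot/exact_rot e wX wZ.
apply: wge0_of_orth => N wN x.
have [|y ->] := exact_weak_kernel (x := x) e.
  exact: wle0_wge1_orth wN (shifted1 wZ).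
by rewrite (wle0_wge1_orth y wN (shifted1 wX)) mcompm0.
Qed.

(** * The functors Gr_0 as universal arrows *)

(** Not restricted to sources in the heart, unlike the uniqueness built into
    [is_Gr0_right]: the uniqueness of [alpha] is a cancellation of [i0] after
    morphisms out of [Mm], which only has weights at most 0. *)
Lemma wge1_exact_mono (A B M N : T)
    (d : mor A B) (i : mor B M) (h : mor M A⟦1⟧) (g g' : mor N B) :
  exact d i h -> wge w 1 A -> wle0 w N -> i ∘ g = i ∘ g' -> g = g'.
Proof.
move=> e wA wN igg'; apply/eqP; rewrite -subr_eq0; apply/eqP.
have [|y ->] := exact_weak_kernel (x := g - g') e.
  by rewrite mcompBr igg' subrr.
by rewrite (wle0_wge1_orth y wN wA) mcompm0.
Qed.

(** A morphism from [M] to the heart factors through [pi] because it vanishes on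
    [A], uniquely because [A⟦1⟧] still has no morphism to the heart: this is
    where the gap at weight -1 is used. *)
Lemma Gr0_left_of_exact (A M G : T)
    (f : mor A M) (pi : mor M G) (d : mor G A⟦1⟧) :
  exact f pi d -> wle w (-2) A -> heart w G -> is_Gr0_left w pi.
Proof.
move=> e /wle_m2_shift wA1 hG; split=> // N [_ wN] x.
have xf : x ∘ f = 0.
  apply: shift_inj; rewrite fmap0 fmapM.
  by rewrite (wle0_wge1_orth (_ ∘ _) (wle_m1_wle0 wA1) (shifted1 wN)).
have [g ->] := exact_weak_cokernel e xf.
exists g; split=> // g' gg'; apply/eqP; rewrite -subr_eq0; apply/eqP.
have [|y ->] := exact_weak_cokernel (x := g - g') (proj1 (exact_rot _ _ _) e).
  by rewrite mcompBl gg' subrr.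
by rewrite (wle_m1_wge0_orth y wA1 wN) mcomp0m.
Qed.

(** The gap at weight 1 enters through [wge w 1 A]: it makes morphisms from the
    heart to [A] vanish, hence factorizations through [i] unique. *)
Lemma Gr0_right_of_exact (A M G : T)
    (d : mor A G) (i : mor G M) (h : mor M A⟦1⟧) :
  exact d i h -> wge w 1 A -> heart w G -> is_Gr0_right w i.
Proof.
move=> e wA hG; split=> // N [wN _] x.
have hx : h ∘ x = 0.
  by apply: wle0_wge1_orth wN (shifted1 _); apply: wge0_sub.
have [g ->] := exact_weak_kernel (proj1 (exact_rot _ _ _) e) hx.
by exists g; split=> // g' /(wge1_exact_mono e wA wN).
Qed.

Lemma Gr0_left_epi (M G N : T) (pi : mor M G) (g g' : mor G N) :
  is_Gr0_left w pi -> heart w N -> g ∘ pi = g' ∘ pi -> g = g'.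
Proof.
move=> [_ univ] hN e; have [k [_ uniq_k]] := univ N hN (g ∘ pi).
by rewrite -(uniq_k g) // -(uniq_k g').
Qed.

Lemma Gr0_right_mono (M G N : T) (i : mor G M) (g g' : mor N G) :
  is_Gr0_right w i -> heart w N -> i ∘ g = i ∘ g' -> g = g'.
Proof.
move=> [_ univ] hN e; have [k [_ uniq_k]] := univ N hN (i ∘ g).
by rewrite -(uniq_k g) // -(uniq_k g').
Qed.

Lemma Gr0_left_unique (M G G' : T) (pi : mor M G) (pi' : mor M G') :
  is_Gr0_left w pi -> is_Gr0_left w pi' ->
  exists (p : mor G G') (q : mor G' G), inverse_morphisms p q /\ p ∘ pi = pi'.
Proof.
move=> H H'; have [p [ppi _]] := proj2 H _ (proj1 H') pi'.
have [q [qpi' _]] := proj2 H' _ (proj1 H) pi.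
exists p, q; split=> //; split.
  by apply: (Gr0_left_epi H (proj1 H)); rewrite -mcompA ppi qpi' mcomp1m.
by apply: (Gr0_left_epi H' (proj1 H')); rewrite -mcompA qpi' ppi mcomp1m.
Qed.

Lemma Gr0_right_unique (M G G' : T) (i : mor G M) (i' : mor G' M) :
  is_Gr0_right w i -> is_Gr0_right w i' ->
  exists (p : mor G G') (q : mor G' G), inverse_morphisms p q /\ i' ∘ p = i.
Proof.
move=> H H'; have [p [ip _]] := proj2 H' _ (proj1 H) i.
have [q [iq _]] := proj2 H _ (proj1 H') i'.
exists p, q; split=> //; split.
  by apply: (Gr0_right_mono H (proj1 H)); rewrite mcompA iq ip mcompm1.
by apply: (Gr0_right_mono H' (proj1 H')); rewrite mcompA ip iq mcompm1.
Qed.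

Lemma Gr0_left_connecting_unique (A M G : T)
    (f : mor A M) (pi : mor M G) (d d' : mor G A⟦1⟧) :
  is_Gr0_left w pi -> exact f pi d -> exact f pi d' -> d = d'.
Proof.
move=> H e e'.
have [|c [cpi dd']] := exact_fill (a := idm A) (b := idm M) e e'.
  by rewrite mcompm1 mcomp1m.
move: dd'; rewrite fmap1 mcomp1m => ->.
suff -> : c = idm G by rewrite mcompm1.
by apply: (Gr0_left_epi H (proj1 H)); rewrite cpi mcompm1 mcomp1m.
Qed.

(** Rotate twice, so that the two unequal morphisms are connected by an
    endomorphism of [G⟦1⟧], and descend it to [G]. *)
Lemma Gr0_right_connecting_unique (A M G : T)
    (d d' : mor A G) (i : mor G M) (h : mor M A⟦1⟧) :
  is_Gr0_right w i -> exact d i h -> exact d' i h -> d = d'.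
Proof.
move=> H /exact_rot/exact_rot e /exact_rot/exact_rot e'.
have [|c [cd ic]] := exact_fill (a := idm M) (b := idm A⟦1⟧) e e'.
  by rewrite mcompm1 mcomp1m.
move: cd ic; have [k <-] := shift_full c.
rewrite fmap1 mcomp1m mcompm1 mcompmN mcompNm -!fmapM.
move=> /oppr_inj/shift_inj kd /oppr_inj/shift_inj ik.
have k1 : k = idm G by apply: (Gr0_right_mono H (proj1 H)); rewrite -ik mcompm1.
by rewrite -kd k1 mcomp1m.
Qed.

End Triangulated.

(** * Comparing the graded pieces *)

Theorem theorem2p4 (T : triangulated) (w : weight_structure T)
  (Mm Mp C : T) (u : mor Mm Mp) (vm : mor C Mm) (vp : mor Mp C⟦1⟧)
  (hMm : wle0 w Mm) (hMp : wge0 w Mp) (huv : exact vm u vp)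
  (Cle Cge : T) (cm : mor Cle C) (cp : mor C Cge) (dC : mor Cge Cle⟦1⟧)
  (hC : weight_filtration_avoiding w (-1) 0 cm cp dC) :
  (without_weights w (-1) (-1) Mm /\ without_weights w 1 1 Mp) /\
  forall (Grm : T) (pi0 : mor Mm Grm) (Grp : T) (i0 : mor Grp Mp),
    is_Gr0_left w pi0 -> is_Gr0_right w i0 ->
    exists (dm : mor Grm Cle⟦1⟧) (dp : mor Cge Grp),
    [/\ unique (fun d : mor Grm Cle⟦1⟧ => exact (vm ∘ cm) pi0 d) dm,
        unique (fun d : mor Cge Grp => exact d i0 (cp⟦1⟧m ∘ vp)) dp,
        weight_filtration_avoiding w (-1) (-1) (vm ∘ cm) pi0 dm
      & weight_filtration_avoiding w 1 1 i0 (cp⟦1⟧m ∘ vp) (- dp⟦1⟧m)] /\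
    exists (alpha : mor Grm Grp) (alphaV : mor Grp Grm),
    [/\ inverse_morphisms alpha alphaV,
        unique (fun a : mor Grm Grp => i0 ∘ a ∘ pi0 = u) alpha
      & dm ∘ alphaV ∘ dp = dC].
Proof.
have [_ eC wCle wCge] := hC.
have wCle0 := wle_m1_wle0 (wle_m2_shift wCle).
have [G [k1 [k2 eM]]] := exact_cone (vm ∘ cm).
have [a [b [eP acp bk1 k2a _]]] := exact_octahedron eC huv eM.
have hG : heart w G.
  split; first exact: wle0_extension (proj1 (exact_rot _ _ _) eM) hMm wCle0.
  by apply: wge0_extension eP _ hMp; apply: wge0_sub.
have eP' := proj1 (exact_rot _ _ _) eP.
have wCge2 := wge_shift wCge.
split.
  split.
    by exists Cle, G, (vm ∘ cm), k1, k2; split=> //; apply/shifted0/(proj2 hG).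
  exists G, Cge⟦1⟧, b, (cp⟦1⟧m ∘ vp), (- a⟦1⟧m); split=> //.
  exact/shifted0/(proj1 hG).
move=> Grm pi0 Grp i0 Hm Hp.
have [p [q [[qp pq] ppi]]] := Gr0_left_unique (Gr0_left_of_exact eM wCle hG) Hm.
have [r [s [[sr rs] ir]]] := Gr0_right_unique (Gr0_right_of_exact eP wCge hG) Hp.
have em : exact (vm ∘ cm) pi0 (k2 ∘ q).
  apply: (exact_iso (is_iso_id Cle) (is_iso_id Mm) (c := p) _ _ _ _ eM).
  - by exists q.
  - by rewrite mcompm1 mcomp1m.
  - by rewrite mcompm1.
  - by rewrite fmap1 mcomp1m -mcompA qp mcompm1.
have ep : exact (r ∘ a) i0 (cp⟦1⟧m ∘ vp).
  apply: (exact_iso (is_iso_id Cge) (b := r) _ (is_iso_id Mp) _ _ _ eP).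
  - by exists s.
  - by rewrite mcompm1.
  - by rewrite ir mcomp1m.
  - by rewrite fmap1 mcomp1m mcompm1.
exists (k2 ∘ q), (r ∘ a); split.
  split.
  - by split=> // d; apply: Gr0_left_connecting_unique Hm em.
  - by split=> // d; apply: Gr0_right_connecting_unique Hp ep.
  - by split=> //; apply/shifted0/(proj2 (proj1 Hm)).
  - split=> //; first exact: (proj1 (exact_rot _ _ _) ep).
    exact/shifted0/(proj1 (proj1 Hp)).
have iap : i0 ∘ (r ∘ q) ∘ pi0 = u.
  by rewrite mcompA ir -ppi -mcompA (mcompA q) qp mcomp1m.
exists (r ∘ q), (p ∘ s); split.
- split.
    by rewrite -mcompA (mcompA s) sr mcomp1m.
  by rewrite -mcompA (mcompA q) qp mcomp1m.
- split=> // c icp; apply: (Gr0_left_epi Hm (proj1 Hp)).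
  by apply: (wge1_exact_mono ep wCge hMm); rewrite (mcompA i0 c) icp (mcompA i0) iap.
- by rewrite -!mcompA (mcompA s) sr mcomp1m (mcompA q) qp mcomp1m.
Qed.
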